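(* Let $A$ be a 3-restricted (or 4-restricted) semi-Segal type with degeneracies. Then $A$ is complete if and only if it is univalent as a wild precategory.
   Context: Work in homotopy type theory (intensional Martin-Löf type theory with $\Pi$-, $\Sigma$-, unit and identity types and a univalent universe $\mathcal U$). Semi-Segal types. For $0\le n\le 4$, an $n$-restricted semisimplicial type is a tuple $(A_0,\dots,A_n)$ with $A_0:\mathcal U$ and, for $1\le k\le n$, $A_k:\partial\mathbf\Delta^k\to\mathcal U$. Here $\partial\mathbf\Delta^k$ is the iterated $\Sigma$-type with one component $x_S$ for every nonempty proper subset $S\subsetneq\{0,\dots,k\}$, where $x_S:A_{|S|-1}\big((x_T)_{\emptyset\ne T\subsetneq S}\big)$ (reindexed along the order-preserving bijection $S\cong\{0,\dots,|S|-1\}$), and $x_i:A_0$ for singletons. $\mathbf\Delta^k$ is the same $\Sigma$-type with one further component $x_{0\cdots k}:A_k(\ldots)$ over that boundary. For $2\le k\le n$ and $0\le m\le k$, $\Lambda^k_m$ is the $\Sigma$-type with the same components as $\partial\mathbf\Delta^k$ except that $x_{\{0,\dots,k\}\setminus\{m\}}$ is removed. The type of fillers of $u:\Lambda^k_m$ is the type of pairs $(x_{\{0,\dots,k\}\setminus\{m\}},x_{\{0,\dots,k\}})$; $u$ has contractible filling if this type is contractible. An $n$-restricted semi-Segal type ($1\le n\le4$) is an $n$-restricted semisimplicial type where every $u:\Lambda^p_1$ has contractible filling, for every $p\in\{2,\dots,n\}$. Degeneracy structures. A 2-degeneracy structure is a function $s^0_0:\Pi(x_0:A_0),A_1(x_0,x_0)$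 together with functions assigning to each $(x_0,x_1,x_{01}):\mathbf\Delta^1$ an element of $A_2(u)$ for the boundaries $u$: for $s^1_0$: $u_0=u_1=x_0$, $u_2=x_1$, $u_{01}=s^0_0(x_0)$, $u_{02}=u_{12}=x_{01}$; for $s^1_1$: $u_0=x_0$, $u_1=u_2=x_1$, $u_{01}=u_{02}=x_{01}$, $u_{12}=s^0_0(x_1)$. A 3-degeneracy structure is a 2-degeneracy structure together with functions assigning to each $x:\mathbf\Delta^2$ (with components $x_0,x_1,x_2,x_{01},x_{12},x_{02},x_{012}$) an element of $A_3(u)$ for the boundaries $u$: for $s^2_0$: $u_0=u_1=x_0$, $u_2=x_1$, $u_3=x_2$; $u_{01}=s^0_0(x_0)$, $u_{02}=u_{12}=x_{01}$, $u_{03}=u_{13}=x_{02}$, $u_{23}=x_{12}$; $u_{012}=s^1_0(x_{01})$, $u_{013}=s^1_0(x_{02})$, $u_{023}=u_{123}=x_{012}$; for $s^2_1$: $u_0=x_0$, $u_1=u_2=x_1$, $u_3=x_2$; $u_{01}=u_{02}=x_{01}$, $u_{12}=s^0_0(x_1)$, $u_{03}=x_{02}$, $u_{13}=u_{23}=x_{12}$; $u_{012}=s^1_1(x_{01})$, $u_{013}=u_{023}=x_{012}$, $u_{123}=s^1_0(x_{12})$; for $s^2_2$: $u_0=x_0$, $u_1=x_1$, $u_2=u_3=x_2$; $u_{01}=x_{01}$, $u_{02}=u_{03}=x_{02}$, $u_{12}=u_{13}=x_{12}$, $u_{23}=s^0_0(x_2)$; $u_{012}=u_{013}=x_{012}$,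 $u_{023}=s^1_1(x_{02})$, $u_{123}=s^1_1(x_{12})$. A 3- (resp. 4-) restricted semi-Segal type with degeneracies is a 3- (resp. 4-) restricted semi-Segal type equipped with a 2- (resp. 3-) degeneracy structure. Completeness. An edge $e:A_1(a,b)$ is neutral if every horn $u:\Lambda^2_0$ with $u_{01}\equiv e$ and every horn $u:\Lambda^2_2$ with $u_{12}\equiv e$ has contractible filling; this proposition is written $\mathsf{isNeutral}(e)$. $A$ is complete if $\Pi(x:A_0),\ \mathsf{isContr}\big(\Sigma(y:A_0),(e:A_1(y,x)),\mathsf{isNeutral}(e)\big)$. Univalence. The wild precategory corresponding to $A$ has objects $A_0$, morphisms $\mathsf{Hom}(x,y)=A_1(x,y)$, identities $\mathsf{Id}=s^0_0$, and composition $x_{12}\circ x_{01}$ given by the $x_{02}$-component of the unique filler of the $\Lambda^2_1$-horn given by $x_{01},x_{12}$ (so $A_2(\ldots)\simeq(x_{12}\circ x_{01}=x_{02})$; the associator comes from $A_3$ and the unitors from $s^1_0,s^1_1$). For $f:\mathsf{Hom}(x,y)$, $\mathsf{isIso}(f):\equiv\big(\Sigma(g:\mathsf{Hom}(y,x)),g\circ f=\mathsf{Id}_x\big)\times\big(\Sigma(g:\mathsf{Hom}(y,x)),f\circ g=\mathsf{Id}_y\big)$ and $x\cong y:\equiv\Sigma(f:\mathsf{Hom}(x,y)),\mathsf{isIso}(f)$. By the unitors $\mathsf{Id}_x$ is its own inverse, and $\mathsf{idtoiso}:x=y\to x\cong y$ is defined by path induction sending $\mathsf{refl}_x$ to $\mathsf{Id}_x$.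 Univalent means that $\mathsf{idtoiso}$ is an equivalence for all $x,y$. *)

(* Defs.v *)
(* Only the Rocq prelude is used (Pi, sigT, prod); no axioms are assumed here. *)

Set Implicit Arguments.
Unset Strict Implicit.

(* The fixed universe.  Everything below is relative to this single level. *)
Definition U := Type.

(* The identity type of homotopy type theory.  The prelude's [eq] is not used:
   it lives in the impredicative sort [Prop], whereas here the identity types
   of a type in [U] are again types in [U], with no uniqueness assumed. *)
Inductive paths {A : U} (x : A) : A -> U := idpath : paths x x.
Arguments idpath {A} x, {A x}.

Notation "x == y" := (paths x y) (at level 70, no associativity).

Definition ap {A B : U} (f : A -> B) {x y : A} (p : x == y) : f x == f y :=
  match p in paths _ z return f x == f z with idpath => idpath end.

Definition isContr (A : U) : U := {c : A & forall y : A, c == y}.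

Definition isEquiv {A B : U} (f : A -> B) : U :=
  forall b : B, isContr {a : A & f a == b}.

(* Logical equivalence of types. *)
Definition iffU (P Q : U) : U := ((P -> Q) * (Q -> P))%type.

Definition happly {A : U} {B : A -> U} {f g : forall x, B x} (p : f == g) :
    forall x, f x == g x :=
  match p in paths _ h return forall x, f x == h x
  with idpath => fun x => idpath end.

(* Function extensionality in U, the consequence of the univalence of U on
   which the results about neutrality and invertibility depend.  Univalence
   itself is not postulated: the prelude's [eq : Prop] eliminates into Type and
   is thus equivalent to [paths], so univalence would resize the loop space of
   every type into the impredicative sort Prop. *)
Definition Funext : Type :=
  forall (A : U) (B : A -> U) (f g : forall x, B x),
    isEquiv (@happly A B f g).

(** * Restricted semisimplicial types *)

(* The families A_k : (boundary of the k-simplex) -> U are curried.  Faces are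
   listed in lexicographic order of their vertex sets; those that can be read
   off from higher faces are implicit. *)
Record SemiSimplicial2 : Type := {
  A0 : U;
  A1 : A0 -> A0 -> U;
  A2 : forall x0 x1 x2 : A0, A1 x0 x1 -> A1 x0 x2 -> A1 x1 x2 -> U
}.
Arguments A1 {s} x0 x1 : rename.
Arguments A2 {s x0 x1 x2} x01 x02 x12 : rename.

Record SemiSimplicial3 : Type := {
  ss2 :> SemiSimplicial2;
  A3 : forall (x0 x1 x2 x3 : A0 ss2)
      (x01 : A1 x0 x1) (x02 : A1 x0 x2) (x03 : A1 x0 x3)
      (x12 : A1 x1 x2) (x13 : A1 x1 x3) (x23 : A1 x2 x3),
    A2 x01 x02 x12 -> A2 x01 x03 x13 -> A2 x02 x03 x23 -> A2 x12 x13 x23 -> U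
}.
Arguments A3 {s x0 x1 x2 x3 x01 x02 x03 x12 x13 x23} x012 x013 x023 x123 : rename.

Record SemiSimplicial4 : Type := {
  ss3 :> SemiSimplicial3;
  A4 : forall (x0 x1 x2 x3 x4 : A0 ss3)
      (x01 : A1 x0 x1) (x02 : A1 x0 x2) (x03 : A1 x0 x3) (x04 : A1 x0 x4)
      (x12 : A1 x1 x2) (x13 : A1 x1 x3) (x14 : A1 x1 x4)
      (x23 : A1 x2 x3) (x24 : A1 x2 x4) (x34 : A1 x3 x4)
      (x012 : A2 x01 x02 x12) (x013 : A2 x01 x03 x13) (x014 : A2 x01 x04 x14)
      (x023 : A2 x02 x03 x23) (x024 : A2 x02 x04 x24) (x034 : A2 x03 x04 x34)
      (x123 : A2 x12 x13 x23) (x124 : A2 x12 x14 x24) (x134 : A2 x13 x14 x34)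
      (x234 : A2 x23 x24 x34),
    A3 x012 x013 x023 x123 -> A3 x012 x014 x024 x124 ->
    A3 x013 x014 x034 x134 -> A3 x023 x024 x034 x234 ->
    A3 x123 x124 x134 x234 -> U
}.
Arguments A4 {s x0 x1 x2 x3 x4 x01 x02 x03 x04 x12 x13 x14 x23 x24 x34
  x012 x013 x014 x023 x024 x034 x123 x124 x134 x234}
  x0123 x0124 x0134 x0234 x1234 : rename.

(** * Fillers of horns *)

(* [fillerkm] takes the highest-dimensional components of a horn of shape
   Lambda^k_m; the remaining components are implicit where determined. *)

Definition filler20 {A : SemiSimplicial2} {x0 x1 x2 : A0 A}
    (x01 : A1 x0 x1) (x02 : A1 x0 x2) : U :=
  {x12 : A1 x1 x2 & A2 x01 x02 x12}.

Definition filler21 {A : SemiSimplicial2} {x0 x1 x2 : A0 A}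
    (x01 : A1 x0 x1) (x12 : A1 x1 x2) : U :=
  {x02 : A1 x0 x2 & A2 x01 x02 x12}.

Definition filler22 {A : SemiSimplicial2} {x0 x1 x2 : A0 A}
    (x02 : A1 x0 x2) (x12 : A1 x1 x2) : U :=
  {x01 : A1 x0 x1 & A2 x01 x02 x12}.

Definition filler31 {A : SemiSimplicial3} {x0 x1 x2 x3 : A0 A}
    {x01 : A1 x0 x1} {x02 : A1 x0 x2} {x03 : A1 x0 x3}
    {x12 : A1 x1 x2} {x13 : A1 x1 x3} {x23 : A1 x2 x3}
    (x012 : A2 x01 x02 x12) (x013 : A2 x01 x03 x13) (x123 : A2 x12 x13 x23)
    : U :=
  {x023 : A2 x02 x03 x23 & A3 x012 x013 x023 x123}.

Definition filler41 {A : SemiSimplicial4} {x0 x1 x2 x3 x4 : A0 A}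
    {x01 : A1 x0 x1} {x02 : A1 x0 x2} {x03 : A1 x0 x3} {x04 : A1 x0 x4}
    {x12 : A1 x1 x2} {x13 : A1 x1 x3} {x14 : A1 x1 x4}
    {x23 : A1 x2 x3} {x24 : A1 x2 x4} {x34 : A1 x3 x4}
    {x012 : A2 x01 x02 x12} {x013 : A2 x01 x03 x13} {x014 : A2 x01 x04 x14}
    {x023 : A2 x02 x03 x23} {x024 : A2 x02 x04 x24} {x034 : A2 x03 x04 x34}
    {x123 : A2 x12 x13 x23} {x124 : A2 x12 x14 x24} {x134 : A2 x13 x14 x34}
    {x234 : A2 x23 x24 x34}
    (x0123 : A3 x012 x013 x023 x123) (x0124 : A3 x012 x014 x024 x124)
    (x0134 : A3 x013 x014 x034 x134) (x1234 : A3 x123 x124 x134 x234) : U :=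
  {x0234 : A3 x023 x024 x034 x234 & A4 x0123 x0124 x0134 x0234 x1234}.

Definition hasFillers21 (A : SemiSimplicial2) : U :=
  forall (x0 x1 x2 : A0 A) (x01 : A1 x0 x1) (x12 : A1 x1 x2),
    isContr (filler21 x01 x12).

Definition hasFillers31 (A : SemiSimplicial3) : U :=
  forall (x0 x1 x2 x3 : A0 A)
      (x01 : A1 x0 x1) (x02 : A1 x0 x2) (x03 : A1 x0 x3)
      (x12 : A1 x1 x2) (x13 : A1 x1 x3) (x23 : A1 x2 x3)
      (x012 : A2 x01 x02 x12) (x013 : A2 x01 x03 x13) (x123 : A2 x12 x13 x23),
    isContr (filler31 x012 x013 x123).

Definition hasFillers41 (A : SemiSimplicial4) : U :=
  forall (x0 x1 x2 x3 x4 : A0 A)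
      (x01 : A1 x0 x1) (x02 : A1 x0 x2) (x03 : A1 x0 x3) (x04 : A1 x0 x4)
      (x12 : A1 x1 x2) (x13 : A1 x1 x3) (x14 : A1 x1 x4)
      (x23 : A1 x2 x3) (x24 : A1 x2 x4) (x34 : A1 x3 x4)
      (x012 : A2 x01 x02 x12) (x013 : A2 x01 x03 x13) (x014 : A2 x01 x04 x14)
      (x023 : A2 x02 x03 x23) (x024 : A2 x02 x04 x24) (x034 : A2 x03 x04 x34)
      (x123 : A2 x12 x13 x23) (x124 : A2 x12 x14 x24) (x134 : A2 x13 x14 x34)
      (x234 : A2 x23 x24 x34)
      (x0123 : A3 x012 x013 x023 x123) (x0124 : A3 x012 x014 x024 x124)
      (x0134 : A3 x013 x014 x034 x134) (x1234 : A3 x123 x124 x134 x234),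
    isContr (filler41 x0123 x0124 x0134 x1234).

(** * Degeneracy structures *)

Record Degeneracy2 (A : SemiSimplicial2) : U := {
  s00 : forall x0 : A0 A, A1 x0 x0;
  s10 : forall (x0 x1 : A0 A) (x01 : A1 x0 x1), A2 (s00 x0) x01 x01;
  s11 : forall (x0 x1 : A0 A) (x01 : A1 x0 x1), A2 x01 x01 (s00 x1)
}.
Arguments s00 {A} d x0 : rename.
Arguments s10 {A} d {x0 x1} x01 : rename.
Arguments s11 {A} d {x0 x1} x01 : rename.

Record Degeneracy3 (A : SemiSimplicial3) : U := {
  deg2 :> Degeneracy2 A;
  s20 : forall (x0 x1 x2 : A0 A)
      (x01 : A1 x0 x1) (x02 : A1 x0 x2) (x12 : A1 x1 x2)
      (x012 : A2 x01 x02 x12),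
    A3 (s10 deg2 x01) (s10 deg2 x02) x012 x012;
  s21 : forall (x0 x1 x2 : A0 A)
      (x01 : A1 x0 x1) (x02 : A1 x0 x2) (x12 : A1 x1 x2)
      (x012 : A2 x01 x02 x12),
    A3 (s11 deg2 x01) x012 x012 (s10 deg2 x12);
  s22 : forall (x0 x1 x2 : A0 A)
      (x01 : A1 x0 x1) (x02 : A1 x0 x2) (x12 : A1 x1 x2)
      (x012 : A2 x01 x02 x12),
    A3 x012 x012 (s11 deg2 x02) (s11 deg2 x12)
}.

(* n-restricted semi-Segal types with degeneracies, for n = 3, 4. *)
Record SemiSegalDeg3 : Type := {
  sd3_ss :> SemiSimplicial3;
  sd3_fill21 : hasFillers21 sd3_ss;
  sd3_fill31 : hasFillers31 sd3_ss;
  sd3_deg : Degeneracy2 sd3_ss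
}.
Arguments sd3_fill21 : clear implicits.
Arguments sd3_fill31 : clear implicits.

Record SemiSegalDeg4 : Type := {
  sd4_ss :> SemiSimplicial4;
  sd4_fill21 : hasFillers21 sd4_ss;
  sd4_fill31 : hasFillers31 sd4_ss;
  sd4_fill41 : hasFillers41 sd4_ss;
  sd4_deg : Degeneracy3 sd4_ss
}.
Arguments sd4_fill21 : clear implicits.
Arguments sd4_fill31 : clear implicits.
Arguments sd4_fill41 : clear implicits.

(** * Completeness *)

Definition isNeutral {A : SemiSimplicial2} {a b : A0 A} (e : A1 a b) : U :=
  ((forall (c : A0 A) (x02 : A1 a c), isContr (filler20 e x02)) *
   (forall (c : A0 A) (x02 : A1 c b), isContr (filler22 x02 e)))%type.

Definition isComplete (A : SemiSimplicial2) : U :=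
  forall x : A0 A, isContr {y : A0 A & {e : A1 y x & isNeutral e}}.

(** * Wild precategories and univalence *)

Record WildPrecategory : Type := {
  Ob : U;
  Hom : Ob -> Ob -> U;
  Id : forall x : Ob, Hom x x;
  comp : forall x y z : Ob, Hom y z -> Hom x y -> Hom x z;
  assoc : forall (w x y z : Ob) (h : Hom y z) (g : Hom x y) (f : Hom w x),
    comp h (comp g f) == comp (comp h g) f;
  unitr : forall (x y : Ob) (f : Hom x y), comp f (Id x) == f;
  unitl : forall (x y : Ob) (f : Hom x y), comp (Id y) f == f
}.
Arguments Hom {w} x y : rename.
Arguments Id {w} x : rename.
Arguments comp {w x y z} g f : rename.
Arguments unitl {w x y} f : rename.

Definition isIso {C : WildPrecategory} {x y : Ob C} (f : Hom x y) : U :=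
  ({g : Hom y x & comp g f == Id x} * {g : Hom y x & comp f g == Id y})%type.

Definition iso {C : WildPrecategory} (x y : Ob C) : U :=
  {f : Hom x y & isIso f}.

Definition idiso {C : WildPrecategory} (x : Ob C) : iso x x :=
  existT _ (Id x)
    (existT _ (Id x) (unitl (Id x)), existT _ (Id x) (unitl (Id x))).

Definition idtoiso {C : WildPrecategory} (x y : Ob C) (p : x == y) : iso x y :=
  match p in paths _ z return iso x z with idpath => idiso x end.

Definition isUnivalent (C : WildPrecategory) : U :=
  forall x y : Ob C, isEquiv (@idtoiso C x y).

(** * The wild precategory of a semi-Segal type with degeneracies *)

Definition segalComp {A : SemiSimplicial2} (S : hasFillers21 A)
    {x0 x1 x2 : A0 A} (x12 : A1 x1 x2) (x01 : A1 x0 x1) : A1 x0 x2 :=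
  projT1 (projT1 (S _ _ _ x01 x12)).

Definition segalComp_cell {A : SemiSimplicial2} (S : hasFillers21 A)
    {x0 x1 x2 : A0 A} (x12 : A1 x1 x2) (x01 : A1 x0 x1) :
    A2 x01 (segalComp S x12 x01) x12 :=
  projT2 (projT1 (S _ _ _ x01 x12)).

Definition segalComp_unique {A : SemiSimplicial2} (S : hasFillers21 A)
    {x0 x1 x2 : A0 A} {x01 : A1 x0 x1} {x02 : A1 x0 x2} {x12 : A1 x1 x2}
    (x012 : A2 x01 x02 x12) : segalComp S x12 x01 == x02 :=
  ap (fun u : filler21 x01 x12 => projT1 u)
     (projT2 (S _ _ _ x01 x12) (existT _ x02 x012)).

(* The horn has x01 = f, x12 = g, x23 = h, x02 = g f, x13 = h g and
   x03 = (h g) f; its filler provides a triangle from x02 and x23 to x03. *)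
Definition segalAssoc {A : SemiSimplicial3}
    (S : hasFillers21 A) (T : hasFillers31 A)
    (x0 x1 x2 x3 : A0 A) (h : A1 x2 x3) (g : A1 x1 x2) (f : A1 x0 x1) :
    segalComp S h (segalComp S g f) == segalComp S (segalComp S h g) f :=
  segalComp_unique S (projT1 (projT1
    (T _ _ _ _ _ _ _ _ _ _
       (segalComp_cell S g f)
       (segalComp_cell S (segalComp S h g) f)
       (segalComp_cell S h g)))).

Definition segalPrecategory (A : SemiSimplicial3)
    (S : hasFillers21 A) (T : hasFillers31 A) (D : Degeneracy2 A)
    : WildPrecategory :=
  {| Ob := A0 A;
     Hom := @A1 A;
     Id := s00 D;
     comp := fun x y z g f => segalComp S g f;
     assoc := segalAssoc S T;
     unitr := fun x y f => segalComp_unique S (s10 D f);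
     unitl := fun x y f => segalComp_unique S (s11 D f) |}.

Definition precategory3 (A : SemiSegalDeg3) : WildPrecategory :=
  segalPrecategory (sd3_fill21 A) (sd3_fill31 A) (sd3_deg A).

Definition precategory4 (A : SemiSegalDeg4) : WildPrecategory :=
  segalPrecategory (sd4_fill21 A) (sd4_fill31 A) (sd4_deg A).

(* Main.v *)
Require Import Defs.

Set Implicit Arguments.
Unset Strict Implicit.

(** Write a semi-Segal type as its wild precategory.  A triangle with edges
    [f], [h], [g] is the same thing as a path [g o f = h], because the triangles
    with given [f] and [g] form, together with their long edge, a contractible
    type ([triangle_equiv]).  Hence the fillers of the outer horns on an edge
    [e] are the fibres of the maps [- o e] and [e o -], and [e] is neutral
    exactly when both maps have contractible fibres.  If [e] is an isomorphism
    then composing with an inverse is inverse to these maps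
    ([contr_precomp_fibre], [contr_postcomp_fibre]); conversely, the fibres over
    the identities contain a left and a right inverse of [e].  So neutral edges
    and isomorphisms agree as predicates, and both are propositions: neutrality
    by function extensionality, invertibility because for an isomorphism the
    types of left and of right inverses are themselves such fibres.

    Completeness therefore says that the type of all [y] with an isomorphism to
    [x] is contractible ([complete_iff_contr_iso]).  The type of all [y] with a
    path to [x] always is, and a fibrewise map out of a family with contractible
    total space is a fibrewise equivalence if and only if the total space of its
    target is contractible ([isEquiv_of_contr_total], [contr_total_of_equiv]).
    Applied to [idtoiso] this is univalence. *)

(** * Paths and contractible types *)

Definition inverse {A : U} {x y : A} (p : x == y) : y == x :=
  match p in paths _ z return z == x with idpath => idpath end.

Definition concat {A : U} {x y z : A} (p : x == y) (q : y == z) : x == z :=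
  match q in paths _ w return x == w with idpath => p end.

Definition transport {A : U} {P : A -> U} {x y : A} (p : x == y) (u : P x)
    : P y :=
  match p in paths _ z return P z with idpath => u end.

Definition isProp (A : U) : U := forall x y : A, x == y.

Lemma isProp_of_isContr (A : U) (H : isContr A) : isProp A.
Proof.
  intros x y. exact (concat (inverse (projT2 H x)) (projT2 H y)).
Defined.

Lemma isContr_paths (A : U) (H : isContr A) (x y : A) : isContr (x == y).
Proof.
  exists (isProp_of_isContr H x y).
  intros p. destruct p. unfold isProp_of_isContr.
  destruct (projT2 H x). exact idpath.
Qed.

Lemma isContr_retract (A B : U) (r : A -> B) (s : B -> A)
    (rs : forall b, r (s b) == b) : isContr A -> isContr B.
Proof.
  intros H. exists (r (projT1 H)).
  intros b. exact (concat (ap r (projT2 H (s b))) (rs b)).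
Qed.

Lemma isContr_sigT_retract (A : U) (P Q : A -> U)
    (r : forall a, P a -> Q a) (s : forall a, Q a -> P a)
    (rs : forall a (q : Q a), r a (s a q) == q) :
  isContr {a : A & P a} -> isContr {a : A & Q a}.
Proof.
  apply (isContr_retract
    (r := fun u => existT Q (projT1 u) (r _ (projT2 u)))
    (s := fun u => existT P (projT1 u) (s _ (projT2 u)))).
  intros [a q]. exact (ap (existT Q a) (rs a q)).
Qed.

Lemma isContr_sigT (A : U) (P : A -> U) (HA : isContr A)
    (HP : forall a, isContr (P a)) : isContr {a : A & P a}.
Proof.
  exists (existT P (projT1 HA) (projT1 (HP _))).
  intros [a p]. destruct (projT2 HA a).
  exact (ap (existT P _) (projT2 (HP _) p)).
Qed.

Lemma isContr_paths_from (A : U) (x : A) : isContr {y : A & x == y}.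
Proof.
  exists (existT (paths x) x idpath). intros [y p]. destruct p. exact idpath.
Qed.

Lemma isContr_paths_to (A : U) (y : A) : isContr {x : A & x == y}.
Proof.
  exists (existT (fun x => x == y) y idpath).
  intros [x p]. destruct p. exact idpath.
Qed.

Lemma isProp_prod (A B : U) (HA : isProp A) (HB : isProp B) : isProp (A * B)%type.
Proof.
  intros [a b] [a' b']. destruct (HA a a'), (HB b b'). exact idpath.
Qed.

Lemma isProp_forall (fe : Funext) (A : U) (B : A -> U)
    (HB : forall a, isProp (B a)) : isProp (forall a, B a).
Proof.
  intros f g. exact (projT1 (projT1 (fe A B f g (fun a => HB a _ _)))).
Qed.

Lemma isProp_isContr (fe : Funext) (A : U) : isProp (isContr A).
Proof.
  intros H [c' k'].
  assert (HF : isProp (forall y, c' == y)).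
  { apply (isProp_forall fe). intros y.
    exact (isProp_of_isContr (isContr_paths H _ _)). }
  destruct H as [c k]. revert k' HF. destruct (k c'). intros k' HF.
  exact (ap (existT (fun c => forall y, c == y) c) (HF k k')).
Qed.

(** * Equivalences *)

Definition equivInv {A B : U} {f : A -> B} (H : isEquiv f) (b : B) : A :=
  projT1 (projT1 (H b)).

Definition equivInv_section {A B : U} {f : A -> B} (H : isEquiv f) (b : B) :
    f (equivInv H b) == b :=
  projT2 (projT1 (H b)).

(** The fibre of [f] over [b] is a retract of the fibre of [f o g] over [b]: the
    map [(b', p) |-> (g b', p)] has the section that sends [a] to [f a] and
    prepends [ap f (gf a)] to the path.  The latter fibre is, along [fg], the
    contractible type of all [b'] with a path to [b]. *)
Lemma isEquiv_of_inverse (A B : U) (f : A -> B) (g : B -> A)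
    (fg : forall b, f (g b) == b) (gf : forall a, g (f a) == a) : isEquiv f.
Proof.
  intros b.
  apply (isContr_retract (A := {b' : B & f (g b') == b})
    (r := fun u => existT (fun a => f a == b) (g (projT1 u)) (projT2 u))
    (s := fun u => existT (fun b' => f (g b') == b) (f (projT1 u))
                     (concat (ap f (gf (projT1 u))) (projT2 u)))).
  - intros [a p]. destruct p. simpl. destruct (gf a). exact idpath.
  - apply (isContr_sigT_retract
      (r := fun b' (p : b' == b) => concat (fg b') p)
      (s := fun b' (p : f (g b') == b) => concat (inverse (fg b')) p)).
    + intros b' p. destruct p. simpl. destruct (fg b'). exact idpath.
    + exact (isContr_paths_to b).
Qed.

(** Both total spaces being contractible, so are the fibres of the total map,
    and the fibre of [t a] over [q] is a retract of the one over [(a, q)]. *)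
Lemma isEquiv_of_contr_total (A : U) (P Q : A -> U)
    (t : forall a, P a -> Q a)
    (HP : isContr {a : A & P a}) (HQ : isContr {a : A & Q a}) (a : A) :
  isEquiv (t a).
Proof.
  intros q.
  set (tot := fun u : {a : A & P a} => existT Q (projT1 u) (t _ (projT2 u))).
  apply (isContr_retract (A := {u : {a : A & P a} & tot u == existT Q a q})
    (r := fun v =>
      match projT2 v in paths _ w
        return {p : P (projT1 w) & t (projT1 w) p == projT2 w}
      with idpath => existT _ (projT2 (projT1 v)) idpath end)
    (s := fun v => existT (fun u => tot u == existT Q a q)
      (existT P a (projT1 v)) (ap (existT Q a) (projT2 v)))).
  - intros [p h]. simpl in *. destruct h. exact idpath.
  - apply (isContr_sigT HP). intros u. exact (isContr_paths HQ _ _).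
Qed.

Lemma contr_total_of_equiv (A : U) (P Q : A -> U) (t : forall a, P a -> Q a)
    (H : forall a, isEquiv (t a)) :
  isContr {a : A & P a} -> isContr {a : A & Q a}.
Proof.
  apply (isContr_sigT_retract (r := t) (s := fun a => equivInv (H a))).
  intros a. exact (equivInv_section (H a)).
Qed.

(** * Isomorphisms in a wild precategory *)

Section Isomorphisms.
Context {C : WildPrecategory}.

Lemma iso_inverse {x y : Ob C} {f : Hom x y} (i : isIso f) :
  {g : Hom y x & ((comp g f == Id x) * (comp f g == Id y))%type}.
Proof.
  destruct i as [[g gf] [k fk]]. exists g. split; [exact gf|].
  (* g = g (f k) = (g f) k = k *)
  assert (gk : g == k).
  { refine (concat (inverse (unitr g)) _).
    refine (concat (ap (fun u => comp g u) (inverse fk)) _).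
    refine (concat (assoc _ _ _) _).
    exact (concat (ap (fun u => comp u k) gf) (unitl k)). }
  exact (concat (ap (fun u => comp f u) gk) fk).
Qed.

Lemma contr_precomp_fibre {x y : Ob C} {f : Hom x y} (i : isIso f)
    (z : Ob C) (h : Hom x z) : isContr {g : Hom y z & comp g f == h}.
Proof.
  destruct (iso_inverse i) as [g [gf fg]].
  refine (isEquiv_of_inverse (f := fun u => comp u f)
            (g := fun v => comp v g) _ _ h).
  - intros v. refine (concat (inverse (assoc _ _ _)) _).
    exact (concat (ap (fun u => comp v u) gf) (unitr v)).
  - intros v. refine (concat (inverse (assoc _ _ _)) _).
    exact (concat (ap (fun u => comp v u) fg) (unitr v)).
Qed.

Lemma contr_postcomp_fibre {x y : Ob C} {f : Hom x y} (i : isIso f)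
    (z : Ob C) (h : Hom z y) : isContr {g : Hom z x & comp f g == h}.
Proof.
  destruct (iso_inverse i) as [g [gf fg]].
  refine (isEquiv_of_inverse (f := fun u => comp f u)
            (g := fun v => comp g v) _ _ h).
  - intros v. refine (concat (assoc _ _ _) _).
    exact (concat (ap (fun u => comp u v) fg) (unitl v)).
  - intros v. refine (concat (assoc _ _ _) _).
    exact (concat (ap (fun u => comp u v) gf) (unitl v)).
Qed.

(** Given one proof of invertibility, the types of left and of right inverses
    are fibres over identities of pre- and postcomposition. *)
Lemma isProp_isIso {x y : Ob C} (f : Hom x y) : isProp (isIso f).
Proof.
  intros i.
  exact (isProp_prod (isProp_of_isContr (contr_precomp_fibre i (Id x)))
                     (isProp_of_isContr (contr_postcomp_fibre i (Id y))) i).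
Qed.

(** Fixing the target [y] instead of the source matches the direction of the
    edges in completeness, so no isomorphism has to be inverted. *)
Lemma univalent_of_contr_iso :
  (forall y : Ob C, isContr {x : Ob C & iso x y}) -> isUnivalent C.
Proof.
  intros H x y.
  exact (isEquiv_of_contr_total (fun x => @idtoiso C x y)
           (isContr_paths_to y) (H y) (a := x)).
Qed.

Lemma contr_iso_of_univalent :
  isUnivalent C -> forall y : Ob C, isContr {x : Ob C & iso x y}.
Proof.
  intros H y.
  exact (contr_total_of_equiv (fun x => H x y) (isContr_paths_to y)).
Qed.

End Isomorphisms.

(** * Neutral edges *)

Lemma isProp_isNeutral (fe : Funext) (A : SemiSimplicial2) (a b : A0 A)
    (e : A1 a b) : isProp (isNeutral e).
Proof.
  apply isProp_prod;
    apply (isProp_forall fe); intros c;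
    apply (isProp_forall fe); intros h; apply (isProp_isContr fe).
Qed.

Definition triangle_of_path {A : SemiSimplicial2} {S : hasFillers21 A}
    {x0 x1 x2 : A0 A} (f : A1 x0 x1) (g : A1 x1 x2) (h : A1 x0 x2)
    (p : segalComp S g f == h) : A2 f h g :=
  transport (P := fun k => A2 f k g) p (segalComp_cell S g f).

(** The total space over [h] of the triangles is the type of fillers of an
    inner horn, which the Segal condition makes contractible. *)
Lemma triangle_equiv (A : SemiSimplicial2) (S : hasFillers21 A)
    (x0 x1 x2 : A0 A) (f : A1 x0 x1) (g : A1 x1 x2) (h : A1 x0 x2) :
  isEquiv (@triangle_of_path A S x0 x1 x2 f g h).
Proof.
  exact (isEquiv_of_contr_total (@triangle_of_path A S x0 x1 x2 f g)
           (isContr_paths_from _) (S _ _ _ f g) (a := h)).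
Qed.

Section Neutral.
Context {A : SemiSimplicial3}.
Context (S : hasFillers21 A) (T : hasFillers31 A) (D : Degeneracy2 A).

Lemma neutral_of_iso {a b : A0 A} (e : A1 a b) :
  isIso (C := segalPrecategory S T D) e -> isNeutral e.
Proof.
  intros i. split; intros c h.
  - apply (contr_total_of_equiv
      (t := fun k => triangle_of_path (S := S) (f := e) (g := k) (h := h))).
    + intros k. apply triangle_equiv.
    + exact (contr_precomp_fibre i h).
  - apply (contr_total_of_equiv
      (t := fun k => triangle_of_path (S := S) (f := k) (g := e) (h := h))).
    + intros k. apply triangle_equiv.
    + exact (contr_postcomp_fibre i h).
Qed.

(** The outer horns whose long edge is an identity are filled by a left and a
    right inverse. *)
Lemma iso_of_neutral {a b : A0 A} (e : A1 a b) :
  isNeutral e -> isIso (C := segalPrecategory S T D) e.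
Proof.
  intros [l r]. split.
  - destruct (projT1 (l _ (s00 D a))) as [g t].
    exact (existT _ g (segalComp_unique S t)).
  - destruct (projT1 (r _ (s00 D b))) as [g t].
    exact (existT _ g (segalComp_unique S t)).
Qed.

(** The predicates imply each other in both directions; that the round trips
    are identities holds because each of them is a proposition. *)
Lemma complete_iff_contr_iso (fe : Funext) :
  iffU (isComplete A)
       (forall x : A0 A,
          isContr {y : A0 A & iso (C := segalPrecategory S T D) y x}).
Proof.
  split; intros H x.
  - refine (isContr_sigT_retract
      (r := fun y (u : {e : A1 y x & isNeutral e}) =>
        existT _ (projT1 u) (iso_of_neutral (projT2 u)))
      (s := fun y (u : iso (C := segalPrecategory S T D) y x) =>
        existT _ (projT1 u) (neutral_of_iso (projT2 u))) _ (H x)).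
    intros y [e i]. exact (ap (existT _ e) (isProp_isIso _ i)).
  - refine (isContr_sigT_retract
      (r := fun y (u : iso (C := segalPrecategory S T D) y x) =>
        existT _ (projT1 u) (neutral_of_iso (projT2 u)))
      (s := fun y (u : {e : A1 y x & isNeutral e}) =>
        existT _ (projT1 u) (iso_of_neutral (projT2 u))) _ (H x)).
    intros y [e n]. exact (ap (existT _ e) (isProp_isNeutral fe _ n)).
Qed.

Lemma complete_iff_univalent (fe : Funext) :
  iffU (isComplete A) (isUnivalent (segalPrecategory S T D)).
Proof.
  destruct (complete_iff_contr_iso fe) as [toIso toNeutral].
  split; intros H.
  - exact (univalent_of_contr_iso (C := segalPrecategory S T D) (toIso H)).
  - exact (toNeutral (contr_iso_of_univalent H)).
Qed.

End Neutral.

Theorem lemma5p6 (fe : Funext) :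
  ((forall A : SemiSegalDeg3, iffU (isComplete A) (isUnivalent (precategory3 A))) *
   (forall A : SemiSegalDeg4, iffU (isComplete A) (isUnivalent (precategory4 A))))%type.
Proof.
  split; intros A; apply (complete_iff_univalent _ _ _ fe).
Qed.
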